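(* Let $q\equiv 1\pmod 4$ be a power of an odd prime and let $m\ge 2$ be an odd integer. Let $S(x)=s_0x+s_1x^q+\cdots+s_{m-1}x^{q^{m-1}}\in\mathbb{F}_{q^m}[x]$ with $s_0s_{m-1}\ne 0$, where for $i=1,\dots,m-1$ one has $s_i=0$ if $i$ is odd and $s_i=2s_0^{(q^i+1)/2}$ if $i$ is even. Then the radical of the quadratic form $\mathrm{Tr}(xS(x))$ on $\mathbb{F}_{q^{2m}}$ has dimension $2m-2$ over $\mathbb{F}_q$, and the curve $\mathcal{X}: y^q-y=xS(x)$ is a minimal curve over $\mathbb{F}_{q^{2m}}$.
   Context: $\mathrm{Tr}$ denotes the trace map from $\mathbb{F}_{q^{2m}}$ to $\mathbb{F}_q$. For the quadratic form $Q(x)=\mathrm{Tr}(xS(x))$ from $\mathbb{F}_{q^{2m}}$ to $\mathbb{F}_q$, let $B(x,y)=Q(x+y)-Q(x)-Q(y)$; the radical of $Q$ is the $\mathbb{F}_q$-subspace $W=\{x\in\mathbb{F}_{q^{2m}}: B(x,y)=0\ \text{for all } y\in\mathbb{F}_{q^{2m}}\}$. A curve given by an affine equation $y^q-y=xS(x)$ means the smooth, projective, geometrically irreducible curve with that function field; it has exactly one point at infinity, which is rational, so its number of rational points over a finite field is one plus the number of affine solutions over that field. A curve of genus $g$ defined over $\mathbb{F}_{q^{N}}$ is called minimal over $\mathbb{F}_{q^{N}}$ if its number of $\mathbb{F}_{q^N}$-rational points equals $q^N+1-2g\sqrt{q^N}$. *)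

(* Defs.v *)
From HB Require Import structures.
From mathcomp Require Import all_boot all_order all_fingroup all_algebra.
From mathcomp Require Import all_solvable all_field.

Set Implicit Arguments.
Unset Strict Implicit.
Unset Printing Implicit Defensive.

Import Order.TTheory GRing.Theory Num.Theory.
Local Open Scope ring_scope.

Section QuadraticForm.

Variables (k : finFieldType) (L : splittingFieldType k).

(* Tr(x S(x)); the values lie in the base field, seen as 1%VS inside L. *)
Definition trace_form (S : {poly L}) (x : L) : L :=
  galTrace 1 {:L} (x * S.[x]).

Definition polar (Q : L -> L) (x y : L) : L := Q (x + y) - Q x - Q y.

Definition is_radical (Q : L -> L) (W : {vspace L}) : Prop :=
  forall x, x \in W <-> (forall y, polar Q x y = 0).

End QuadraticForm.

(* A smooth projective curve over K is given by its function field F, presented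
   as a finite extension of K(x), i.e. by the finite map x : X -> P^1; X is then
   the normalization of P^1 in F.                                             *)
Section Genus.

Variables (K : fieldType) (F : fieldExtType {fraction {poly K}}).

Definition ff_const (a : K) : F := (tofrac a%:P)%:A.

Definition ff_x : F := (tofrac ('X : {poly K}))%:A.

Definition ff_eval (t : F) (p : {poly K}) : F := (map_poly ff_const p).[t].

(* Coordinate rings of the affine charts x <> oo and x <> 0 of X: the integral
   closures in F of K[x] and of K[1/x].                                       *)
Definition chart0 (z : F) : Prop := integralOver (ff_eval ff_x) z.
Definition chartoo (z : F) : Prop := integralOver (ff_eval ff_x^-1) z.

(* The intersection of the two charts is the principal open set x <> 0 of the
   first one; its ring of sections is the localization at x.                  *)
Definition overlap (z : F) : Prop := exists n, chart0 (ff_x ^+ n * z).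

(* genus = dim_K H^1(X, O_X), where H^1(X, O_X) is the Cech cohomology group
   overlap / (chart0 + chartoo): the classes of e_0, ..., e_(g-1) are a K-basis
   of this quotient.                                                          *)
Definition has_genus (g : nat) : Prop :=
  exists e : 'I_g -> F,
    (forall i, overlap (e i)) /\
    (forall z, overlap z ->
       exists! c : {ffun 'I_g -> K},
         exists u v, [/\ chart0 u, chartoo v &
           z - \sum_(i < g) ff_const (c i) * e i = u + v]).

(* For perfect K this says that the curve is geometrically irreducible. *)
Definition full_constant_field : Prop :=
  forall z : F, algebraicOver ff_const z -> exists a, z = ff_const a.

End Genus.

Section ArtinSchreierCurve.

Variables (K : finFieldType) (q : nat) (f : {poly K}).

(* Y^q - Y - f(x), as a polynomial in Y over K(x). *)
Definition AS_poly : {poly {fraction {poly K}}} :=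
  'X^q - 'X - (tofrac f)%:P.

(* F is the function field of y^q - y = f(x), unique up to isomorphism. *)
Definition AS_function_field (F : fieldExtType {fraction {poly K}}) : Prop :=
  [/\ irreducible_poly AS_poly,
      full_constant_field F &
      exists2 y : F, y ^+ q - y = (tofrac f)%:A & <<1; y>>%VS = fullv].

(* The affine solutions, plus one rational point at infinity (which is the
   situation when the degree of f is prime to q).                             *)
Definition AS_num_points : nat :=
  #|[set P : K * K | P.2 ^+ q - P.2 == f.[P.1]]|.+1.

(* The Hasse-Weil lower bound is attained; sqrtC of a natural number is its
   nonnegative real square root in algC.                                      *)
Definition AS_minimal : Prop :=
  exists F : fieldExtType {fraction {poly K}}, exists g : nat,
    [/\ AS_function_field F, has_genus F g &
        AS_num_points%:R
          = #|K|%:R + 1 - 2 * g%:R * sqrtC #|K|%:R :> algC].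

End ArtinSchreierCurve.

(* Main.v *)
Require Import Defs.
From HB Require Import structures.
From mathcomp Require Import all_boot all_order all_fingroup all_algebra.
From mathcomp Require Import all_solvable all_field.
From mathcomp Require Import zify ring.
From Stdlib Require Import Classical.

Set Implicit Arguments.
Unset Strict Implicit.
Unset Printing Implicit Defensive.

Import Order.TTheory GRing.Theory Num.Theory.
Local Open Scope ring_scope.

(* Choose [b] with [b^2 = s_0] and let [t(x)] be the trace of [b x] to the field
   with [q^2] elements.  Pairing the exponents [i] and [2m - i] gives
   [Tr (x S(x)) = t^2 + t^(2q)], and as [q = 1 mod 4] this vanishes only for
   [t = 0].  So the radical is the kernel of [t], of codimension 2, it is the zero
   set of the form, and additive Hilbert 90 gives [q * q^(2m-2)] affine points.

   For the curve [y^q - y = f] with [d = deg f] prime to [q], give [x^i y^j] with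
   [j < q] the weight [q i + d j], i.e. its pole order at infinity.  Distinct
   monomials have distinct weights, and because [y^q = y + f] the [q]-th power of
   [sum_j a_j y^j] is dominated by [sum_j a_j^q f^j]; hence integrality over
   [K[1/x]] forces weight [<= 0].  This gives the irreducibility of
   [Y^q - Y - f], and it describes the chart at infinity.  On the finite chart, the
   [q]-th power map is injective modulo every irreducible polynomial of [K[x]], so
   [K[x, y]] is integrally closed.  Then [H^1(O)] has as basis the [x^-a y^j] with
   [a > 0] and [q a < d j], and the symmetry [(a, j) -> (d - a, q - j)] shows that
   there are [(q - 1) (d - 1) / 2] of them. *)

(** * Integral elements and cancellation of powers of x *)

Lemma integral_sum (R : comNzRingType) (E : fieldType) (h : {rmorphism R -> E})
    I (r : seq I) (P : pred I) (a : I -> E) :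
  (forall i, P i -> integralOver h (a i)) ->
  integralOver h (\sum_(i <- r | P i) a i).
Proof. by move=> ha; elim/big_ind: _ => //; [exact: integral0|exact: integral_add]. Qed.

Lemma integral_exp (R : comNzRingType) (E : fieldType) (h : {rmorphism R -> E}) a n :
  integralOver h a -> integralOver h (a ^+ n).
Proof.
move=> ha; elim: n => [|n IH]; first by rewrite expr0; exact: integral1.
by rewrite exprS; apply: integral_mul.
Qed.

Lemma expr_cancelV (F : fieldType) (x : F) i n :
  x != 0 -> (i <= n)%N -> x ^+ i * x^-1 ^+ n = x^-1 ^+ (n - i).
Proof.
move=> x0 /subnK {1}<-; rewrite exprD mulrCA -exprMn divff // expr1n mulr1 //.
Qed.

Lemma expr_cancelXV (F : fieldType) (x : F) i n :
  x != 0 -> (i <= n)%N -> x ^+ n * x^-1 ^+ i = x ^+ (n - i).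
Proof.
move=> x0 ni; rewrite -[in RHS](invrK x) -(expr_cancelV _ ni) ?invr_eq0 //.
by rewrite invrK mulrC.
Qed.

Lemma horner_map_sum (R E : nzRingType) (h : {rmorphism R -> E}) (p : {poly R}) z n :
  (size p <= n)%N -> (map_poly h p).[z] = \sum_(i < n) h p`_i * z ^+ i.
Proof.
move=> pn; rewrite (horner_coef_wide _ (n := n)) ?(leq_trans (size_poly _ _)) //.
by apply: eq_bigr => i _; rewrite coef_map.
Qed.

(** * Evaluation of polynomials at x and at 1/x *)

Section PolyEval.

Variables (K F : fieldType) (c : {rmorphism K -> F}).

(** One map serves both charts: [ev x] has image K[x] and [ev x^-1] has image K[1/x]. *)
Definition ev (t : F) : {rmorphism {poly K} -> F} :=
  (horner_eval t \o map_poly c : {rmorphism {poly K} -> F}).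

Lemma evE t (p : {poly K}) : ev t p = (map_poly c p).[t]. Proof. by []. Qed.

Lemma evC t a : ev t a%:P = c a.
Proof. by rewrite evE map_polyC hornerC. Qed.

Lemma evX t : ev t 'X = t.
Proof. by rewrite evE map_polyX hornerX. Qed.

Lemma ev_sum t (p : {poly K}) n : (size p <= n)%N -> ev t p = \sum_(i < n) c p`_i * t ^+ i.
Proof.
by move=> pn; rewrite evE (horner_map_sum _ _ pn).
Qed.

Variables (x : F) (x_transc : forall p, ev x p = 0 -> p = 0).

Lemma transc_neq0 : x != 0.
Proof.
apply/eqP => x0; have := @x_transc 'X; rewrite evX => /(_ x0) /eqP.
by rewrite polyX_eq0.
Qed.

Lemma integral_inv_x n : integralOver (ev x^-1) (x^-1 ^+ n).
Proof. by apply: integral_exp; rewrite -{2}(evX x^-1); exact: integral_id. Qed.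

Lemma integral_cst t a : integralOver (ev t) (c a).
Proof. by rewrite -(evC t); exact: integral_id. Qed.

Lemma integral_at_infinity (p : {poly K}) n :
  (size p <= n.+1)%N -> integralOver (ev x^-1) (ev x p * x^-1 ^+ n).
Proof.
move=> pn; rewrite (ev_sum _ pn) mulr_suml; apply: integral_sum => i _.
have ->: c p`_i * x ^+ i * x^-1 ^+ n = c p`_i * x^-1 ^+ (n - i).
  by rewrite -mulrA expr_cancelV ?transc_neq0 // -ltnS.
by apply: integral_mul; [exact: integral_cst|exact: integral_inv_x].
Qed.

(** A monic equation of degree n for x over K[1/x], multiplied by a large power x^N, becomes a
    polynomial relation in x whose coefficient at x^(N + n) is 1, against the transcendence of x. *)
Lemma not_integral_x : ~ integralOver (ev x^-1) x.
Proof.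
case=> P Pm /rootP; rewrite (horner_map_sum _ _ (leqnn _)) => P0.
pose n := (size P).-1.
have nP : size P = n.+1 by rewrite /n prednK // size_poly_gt0 monic_neq0.
pose N := \max_(i < size P) size (P`_i)%R.
have sN i : (size (P`_i)%R <= N)%N.
  have [iP|iP] := ltnP i (size P); last by rewrite nth_default // size_poly0.
  exact: (leq_bigmax (Ordinal iP)).
(* For [size p <= N] this is the polynomial x^N p(1/x). *)
pose rev (p : {poly K}) := \sum_(i < N.+1) p`_i *: 'X^(N - i).
have srev p : (size (rev p) <= N.+1)%N.
  apply: (leq_trans (size_sum _ _ _)); apply/bigmax_leqP => i _.
  by apply: (leq_trans (size_scale_leq _ _)); rewrite size_polyXn; lia.
have revE (p : {poly K}) : (size p <= N)%N -> ev x (rev p) = x ^+ N * ev x^-1 p.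
  move=> pN; rewrite [in RHS](ev_sum _ (n := N.+1)) ?leqW //.
  rewrite mulr_sumr rmorph_sum; apply: eq_bigr => i _.
  rewrite -mul_polyC rmorphM rmorphXn evC evX [RHS]mulrCA; congr (_ * _).
  by rewrite expr_cancelXV ?transc_neq0 // -ltnS.
pose G := \sum_(i < size P) rev P`_i * 'X^i.
have G0 : G = 0.
  apply: x_transc; rewrite /G rmorph_sum.
  transitivity (x ^+ N * 0); last by rewrite mulr0.
  rewrite -[X in _ = _ * X]P0 mulr_sumr; apply: eq_bigr => i _.
  by rewrite rmorphM rmorphXn evX revE // mulrA.
have : G`_(N + n) = 0 by rewrite G0 coef0.
rewrite /G nP big_ord_recr /= coefD coef_sum big1 => [|i _]; last first.
  rewrite coefMXn; case: ltnP => // _; rewrite nth_default //.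
  by apply: (leq_trans (srev _)); case: i => i /= ?; lia.
rewrite add0r coefMXn ltnNge leq_addl /= addnK.
have -> : P`_n = 1 by move/monicP: Pm; rewrite /lead_coef.
rewrite /rev coef_sum (bigD1 ord0) //= subn0 coefZ coefXn eqxx coef1 mulr1.
rewrite big1 ?addr0; first by move/eqP; rewrite oner_eq0.
move=> i /eqP i0; rewrite coef1; case: eqP => [/= ii|_]; last by rewrite scale0r coef0.
by case: i0; apply: val_inj.
Qed.

End PolyEval.

(** * Irreducible factors and divisibility of coefficients *)

Lemma irreducible_factor_exists (K : fieldType) (p : {poly K}) :
  (1 < size p)%N -> exists2 g, irreducible_poly g & g %| p.
Proof.
have [n] := ubnP (size p); elim: n p => // n IH p; rewrite ltnS => pn p1.
have p0 : p != 0 by rewrite -size_poly_gt0 ltnW.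
have [irr|] := classic (irreducible_poly p); first by exists p.
move=> nirr; have [[r r1 [rp nrp]]|no] :=
  classic (exists2 r : {poly K}, size r != 1%N & r %| p /\ ~~ (r %= p)); last first.
  case: nirr; split=> // r r1 rp; apply/negPn/negP => nrp.
  by case: no; exists r.
have r0 : r != 0 by apply: contraTneq rp => ->; rewrite dvd0p.
have rlt : (size r < size p)%N.
  rewrite ltn_neqAle dvdp_leq // andbT; apply: contra nrp => /eqP E.
  by rewrite -dvdp_size_eqp // E.
have [||g gi gr] := IH r; first exact: leq_trans rlt pn.
  by move: r1 r0; rewrite -size_poly_gt0; case: (size r) => [|[|]].
by exists g => //; apply: dvdp_trans gr rp.
Qed.

Lemma irreducible_dvd_exp (K : fieldType) (g p : {poly K}) n :
  irreducible_poly g -> g %| p ^+ n -> g %| p.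
Proof.
move=> gi gp; apply/negPn/negP; rewrite -irreducible_poly_coprime // => cop.
have := coprimep_expr n cop; rewrite irreducible_poly_coprime // gp //.
Qed.

Lemma poly_dvd_coefs (K : fieldType) (g : {poly K}) (A : {poly {poly K}}) :
  (forall j, g %| A`_j) ->
  exists2 B : {poly {poly K}}, (size B <= size A)%N & A = g%:P * B.
Proof.
move=> gA; exists (\poly_(j < size A) (A`_j %/ g)); first exact: size_poly.
apply/polyP => j; rewrite coefCM coef_poly; case: ltnP => Aj.
  by rewrite mulrC divpK.
by rewrite mulr0 nth_default.
Qed.

(** A monic equation over K is also one over K[x] and over K[1/x], so algebraic constants lie in
    both charts. *)
Lemma integral_ev_const (K F : fieldType) (c : {rmorphism K -> F}) t z :
  algebraicOver c z -> integralOver (ev c t) z.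
Proof.
move=> /integral_algebraic[p pm pz]; exists (map_poly polyC p).
  exact: monic_map.
rewrite -map_poly_comp (eq_map_poly (g := c)) // => a /=; exact: evC.
Qed.

(** * The lattice points that give the genus *)

Section GapCount.

Variables q d : nat.

(** Ordinals start at 0, so the pair stands for (a, j) = (p.1 + 1, p.2 + 1) with 0 < a < d and 0 < j
    < q: the exponents for which x^-a y^j has a pole of order d j - q a > 0 at infinity. *)
Definition gap_set : {set 'I_d.-1 * 'I_q.-1} :=
  [set p : 'I_d.-1 * 'I_q.-1 | (q * p.1.+1 < d * p.2.+1)%N].

Lemma card_gap_set : coprime q d -> (#|gap_set|.*2 = q.-1 * d.-1)%N.
Proof.
move=> cop; pose r (p : 'I_d.-1 * 'I_q.-1) := (rev_ord p.1, rev_ord p.2).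
have rK : involutive r by case=> a j; rewrite /r /= !rev_ordK.
have revE n (i : 'I_n.-1) : ((rev_ord i).+1 = n - i.+1)%N.
  by rewrite /=; move: (ltn_ord i); lia.
have -> : (q.-1 * d.-1 = #|{: 'I_d.-1 * 'I_q.-1}|)%N.
  by rewrite card_prod !card_ord mulnC.
rewrite -(cardsC gap_set) -addnn; congr (_ + _)%N.
rewrite -(card_imset _ (inv_inj rK)); apply: eq_card => p.
rewrite -[in LHS](rK p) (mem_imset _ _ (inv_inj rK)) !inE !revE.
case: p => a j /=; have ad := ltn_ord a; have jq := ltn_ord j.
(* Equality would make d divide a positive number below d; without ties the reflection exchanges the
   set with its complement. *)
have ne : (q * a.+1 != d * j.+1)%N.
  apply/eqP => E; have : (d %| q * a.+1)%N by rewrite E dvdn_mulr.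
  by rewrite Gauss_dvdr 1?coprime_sym // => /dvdn_leq; lia.
by move/eqP: ne; rewrite -leqNgt; nia.
Qed.

End GapCount.

(** * Roots of trinomials, q-th powers of sums, and weights *)

(** Integral coefficients suffice in a monic equation. With a = 0, an n-th root of an integral
    element is integral. *)
Lemma integral_trinomial_root (R : comNzRingType) (E : fieldType) (h : {rmorphism R -> E})
    n a b z :
  (1 < n)%N -> integralOver h a -> integralOver h b -> z ^+ n - a * z = b ->
  integralOver h z.
Proof.
move=> n1 ha hb zE; pose p : {poly E} := 'X^n - (a *: 'X + b%:P).
have sr : (size (a *: 'X + b%:P)%R < size ('X^n : {poly E})%R)%N.
  rewrite size_polyXn; apply: (@leq_ltn_trans 2); last by [].
  apply: (leq_trans (size_polyD _ _)); rewrite geq_max.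
  by rewrite (leq_trans (size_scale_leq _ _)) ?size_polyX // (leq_trans (size_polyC_leq1 _)).
apply: (@integral_root_monic _ _ _ _ p).
- by rewrite monicE /p lead_coefDl ?size_polyN // lead_coefXn.
- by rewrite /root /p !hornerE -zE; apply/eqP; ring.
apply/integral_poly => i; rewrite /p !(coefB, coefD, coefZ, coefX, coefXn, coefC).
apply: integral_sub; first exact: integral_nat.
apply: integral_add; first by apply: integral_mul => //; exact: integral_nat.
by case: ifP => // _; exact: integral0.
Qed.

Lemma expr_pchar_sum (E : fieldType) q I (r : seq I) (P : pred I) (a : I -> E) :
  [pchar E].-nat q ->
  (\sum_(i <- r | P i) a i) ^+ q = \sum_(i <- r | P i) a i ^+ q.
Proof.
move=> hq; apply: (big_morph (fun z => z ^+ q)) => [u v|]; first exact: exprDn_pchar.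
by rewrite expr0n; case: q hq.
Qed.

Lemma size_AS_term (K : fieldType) q d (a f : {poly K}) j :
  a != 0 -> size f = d.+1 -> size (a ^+ q * f ^+ j) = (q * (size a).-1 + d * j).+1%N.
Proof.
move=> a0 sf; have f0 : f != 0 by rewrite -size_poly_gt0 sf.
have fj0 := expf_neq0 j f0; have aq0 := expf_neq0 q a0.
rewrite size_mul //; have := size_exp a q; have := size_exp f j.
move: aq0 fj0; rewrite -!size_poly_gt0 sf /= (mulnC q) (mulnC d).
by case: (size (a ^+ q)) => // u _; case: (size (f ^+ j)) => //= v _ -> ->; rewrite addnS.
Qed.

Lemma AS_weight_inj q d a b i j : coprime q d -> (i < q)%N -> (j < q)%N ->
  (q * a + d * i = q * b + d * j)%N -> i = j.
Proof.
move=> cop; wlog ij : a b i j / (i <= j)%N.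
  move=> H iq jq E; case/orP: (leq_total i j) => ij; first exact: (H a b).
  by apply/esym; apply: (H b a).
move=> iq jq E; have : (q %| d * (j - i))%N.
  by rewrite (_ : (d * (j - i) = (a - b) * q)%N) ?dvdn_mull // mulnBr mulnBl; lia.
rewrite Gauss_dvdr // => /dvdn_leq; lia.
Qed.

(** * The curve [y^q - y = f] over a field of characteristic dividing [q] *)

Section ArtinSchreierPlace.

Variables (K F : fieldType) (c : {rmorphism K -> F}).
Variables (x : F) (x_transc : forall p, ev c x p = 0 -> p = 0).
Variables (q d : nat) (f : {poly K}) (y : F).
Hypothesis q_pchar : [pchar F].-nat q.
Hypothesis q_gt1 : (1 < q)%N.
Hypothesis d_gt1 : (1 < d)%N.
Hypothesis coprime_qd : coprime q d.
Hypothesis size_f : size f = d.+1.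
Hypothesis y_AS : y ^+ q - y = ev c x f.

Local Notation intoo := (integralOver (ev c x^-1)).

Let x0 : x != 0 := transc_neq0 x_transc.

Lemma AS_y_exp : y ^+ q = ev c x f + y.
Proof. by rewrite -y_AS subrK. Qed.

(** The element z = y / x^(d-1) satisfies z^q - x^-((q-1)(d-1)) z = f / x^(q(d-1)), with
    coefficients in K[1/x] because d <= q (d - 1). *)
Lemma integral_y : intoo (y * x^-1 ^+ d.-1).
Proof.
apply: (@integral_trinomial_root _ _ _ q (x^-1 ^+ (q.-1 * d.-1))
  (ev c x f * x^-1 ^+ (d.-1 * q))) => //.
- exact: integral_inv_x.
- by apply: integral_at_infinity => //; rewrite size_f; nia.
rewrite exprMn -exprM AS_y_exp.
have -> : x^-1 ^+ (d.-1 * q) = x^-1 ^+ (q.-1 * d.-1) * x^-1 ^+ d.-1.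
  by rewrite -exprD; congr (_ ^+ _); nia.
ring.
Qed.

Lemma integral_f : intoo (ev c x f * x^-1 ^+ d).
Proof. by apply: integral_at_infinity => //; rewrite size_f. Qed.

Lemma integral_y_exp_q : intoo ((ev c x f + y) * x^-1 ^+ d).
Proof.
rewrite mulrDl; apply: integral_add; first exact: integral_f.
rewrite -[in X in _ ^+ X](prednK (ltnW d_gt1)) exprSr mulrA.
by apply: integral_mul; [exact: integral_y|exact: (integral_inv_x _ _ 1)].
Qed.

(** The q-th power of y^j / x^n is (y^q / x^d)^j / x^(q n - d j), a product of integral elements.
    This is the converse, for monomials, of the weight bound below. *)
Lemma integral_y_power j n : (d * j <= q * n)%N -> intoo (y ^+ j * x^-1 ^+ n).
Proof.
move=> jn; apply: (@integral_trinomial_root _ _ _ q 0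
  (((ev c x f + y) * x^-1 ^+ d) ^+ j * x^-1 ^+ (q * n - d * j))) => //.
- exact: integral0.
- by apply: integral_mul; [apply: integral_exp; exact: integral_y_exp_q|exact: integral_inv_x].
rewrite mul0r subr0 exprMn -AS_y_exp exprMn -mulrA -!exprM -exprD subnKC //.
by rewrite ![(_ * q)%N]mulnC.
Qed.

(* If the weight [w = max (q deg A_j + d j)] exceeded [q n], then in the [q]-th
   power of the given element, divided by [x^(w - 1 - q n)], everything except
   the leading monomial [x] of [(sum_j A_j^q f^j) / x^(w-1)] would be integral
   over [K[1/x]]. *)
Lemma weight_le_of_integral (A : nat -> {poly K}) n :
  intoo ((\sum_(j < q) ev c x (A j) * y ^+ j) * x^-1 ^+ n) ->
  forall j, (j < q)%N -> A j != 0 -> (q * (size (A j)).-1 + d * j <= q * n)%N.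
Proof.
move=> hz j1 j1q Aj1; pose wt j := (q * (size (A j)).-1 + d * j)%N.
rewrite leqNgt; apply/negP; rewrite -/(wt j1) => wj1.
have [j0 Aj0 j0max] := @arg_maxnP _ (Ordinal j1q) (fun j : 'I_q => A j != 0) (fun j => wt j) Aj1.
have {}j0max (j : 'I_q) : A j != 0 -> (wt j <= wt j0)%N by exact: j0max.
pose w0 := wt j0.
have w0n : (q * n < w0)%N := leq_trans wj1 (j0max (Ordinal j1q) Aj1).
pose D := \sum_(j < q) A j ^+ q * f ^+ j.
(* Distinct indices have distinct weights, so the maximum is attained only at [j0] and its leading
   monomial cannot cancel in [D]. *)
have wtlt (j : 'I_q) : j != j0 -> A j != 0 -> (wt j < w0)%N.
  move=> jj0 Aj; rewrite ltn_neqAle j0max // andbT; apply/eqP => E.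
  by move/eqP: jj0; apply; apply/val_inj/(AS_weight_inj coprime_qd _ _ E).
pose l := lead_coef (A j0 ^+ q * f ^+ j0).
have st : size (A j0 ^+ q * f ^+ j0) = w0.+1 by exact: size_AS_term.
have l0 : l != 0 by rewrite lead_coef_eq0 -size_poly_gt0 st.
have sD : (size (D - l *: 'X^w0)%R <= w0.-1.+1)%N.
  rewrite prednK ?(leq_ltn_trans _ w0n) //.
  rewrite /D (bigD1 j0) //= addrAC; apply: (leq_trans (size_polyD _ _)).
  rewrite geq_max; apply/andP; split.
    apply/leq_sizeP => i; rewrite leq_eqVlt => /orP[/eqP <-|iw].
      rewrite coefB coefZ coefXn eqxx mulr1 /l /lead_coef st /= subrr //.
    rewrite coefB coefZ coefXn gtn_eqF // mulr0 subr0 nth_default // st //.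
  apply: (leq_trans (size_sum _ _ _)); apply/bigmax_leqP => j jj0.
  have [->|Aj] := eqVneq (A j) 0; first by rewrite expr0n gtn_eqF ?mul0r ?size_poly0 // ltnW.
  by rewrite (size_AS_term _ _ Aj size_f); exact: wtlt.
(* Replacing y^q = f + y by f costs (f + y)^j - f^j, which is y times a sum of products (f +
   y)^(j-1-i) f^i; each term remains integral after division by x^(w0 - 1). *)
have intE (j : 'I_q) :
    intoo (ev c x (A j) ^+ q * ((ev c x f + y) ^+ j - ev c x f ^+ j) * x^-1 ^+ w0.-1).
  have [->|Aj] := eqVneq (A j) 0.
    by rewrite rmorph0 expr0n gtn_eqF ?mul0r ?(ltnW q_gt1) //; exact: integral0.
  rewrite subrXX (_ : ev c x f + y - _ = y); last by ring.
  rewrite !mulr_sumr mulr_suml; apply: integral_sum => i _.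
  set a := (size (A j)).-1.
  (* Shares of the exponent: a q for A_j^q, d - 1 for y, and d for each factor f + y or f. They add
     up to wt j - 1 <= w0 - 1. *)
  have [r ->] : exists r, w0.-1 = (a * q + d.-1 + d * (j.-1 - i) + d * i + r)%N.
    exists (w0.-1 - (a * q + d.-1 + d * (j.-1 - i) + d * i))%N; rewrite subnKC //.
    have := j0max j Aj; rewrite -/w0 /wt -/a; move: (ltn_ord i); move: (i : nat) => i'.
    by case: (j : nat) => //= j'; rewrite ltnS => ij /=; rewrite -addnA -mulnDr subnK //; nia.
  have -> : ev c x (A j) ^+ q * (y * ((ev c x f + y) ^+ (j.-1 - i) * ev c x f ^+ i)) *
      x^-1 ^+ (a * q + d.-1 + d * (j.-1 - i) + d * i + r) =
     (ev c x (A j) * x^-1 ^+ a) ^+ q * (y * x^-1 ^+ d.-1) *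
     ((ev c x f + y) * x^-1 ^+ d) ^+ (j.-1 - i) * (ev c x f * x^-1 ^+ d) ^+ i * x^-1 ^+ r.
    rewrite !exprMn !exprD -!exprM.
    set u1 := _ ^+ (a * q); set u2 := x^-1 ^+ (d * (j.-1 - i)); set u3 := x^-1 ^+ (d * i).
    set u4 := (_ + y) ^+ _; set u5 := _ ^+ i; ring.
  apply: integral_mul; last exact: integral_inv_x.
  apply: integral_mul; last by apply: integral_exp; exact: integral_f.
  apply: integral_mul; last by apply: integral_exp; exact: integral_y_exp_q.
  apply: integral_mul; last exact: integral_y.
  by apply: integral_exp; apply: integral_at_infinity => //; rewrite /a leqSpred.
have intD : intoo (ev c x D * x^-1 ^+ w0.-1).
  have -> : ev c x D * x^-1 ^+ w0.-1 =
     ((\sum_(j < q) ev c x (A j) * y ^+ j) * x^-1 ^+ n) ^+ q * x^-1 ^+ (w0.-1 - n * q) -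
     \sum_(j < q) (ev c x (A j) ^+ q * ((ev c x f + y) ^+ j - ev c x f ^+ j) * x^-1 ^+ w0.-1).
    rewrite exprMn expr_pchar_sum // -mulrA -exprM -exprD subnKC; last by lia.
    rewrite -mulr_suml -mulrBl; congr (_ * _).
    rewrite -sumrB /D rmorph_sum; apply: eq_bigr => j _.
    rewrite rmorphM !rmorphXn exprMn -exprM [(j * q)%N]mulnC exprM AS_y_exp; ring.
  apply: integral_sub; last by apply: integral_sum.
  by apply: integral_mul; [exact: integral_exp|exact: integral_inv_x].
apply: (not_integral_x x_transc).
(* Removing from [D] everything but its leading term, then dividing by x^(w0 - 1), leaves l x. *)
suff xE : c l^-1 * (ev c x D * x^-1 ^+ w0.-1 - ev c x (D - l *: 'X^w0) * x^-1 ^+ w0.-1) = x.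
  rewrite -[X in integralOver _ X]xE; apply: integral_mul; first exact: integral_cst.
  by apply: integral_sub => //; exact: (integral_at_infinity x_transc sD).
rewrite -mulrBl rmorphB opprB addrC subrK -mul_polyC rmorphM rmorphXn evC evX.
rewrite -mulrA expr_cancelXV //; last by lia.
by rewrite (_ : w0 - w0.-1 = 1)%N ?expr1 ?mulrA -?rmorphM ?mulVf ?rmorph1 ?mul1r //; lia.
Qed.

(** * The ring K[x, y] is integrally closed *)

Definition ev2 : {rmorphism {poly {poly K}} -> F} :=
  (horner_eval y \o map_poly (ev c x) : {rmorphism {poly {poly K}} -> F}).

Lemma ev2E A : ev2 A = (map_poly (ev c x) A).[y]. Proof. by []. Qed.

Lemma ev2C p : ev2 p%:P = ev c x p.
Proof. by rewrite ev2E map_polyC hornerC. Qed.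

Lemma ev2X : ev2 'X = y.
Proof. by rewrite ev2E map_polyX hornerX. Qed.

Lemma ev2_sum (A : {poly {poly K}}) n : (size A <= n)%N ->
  ev2 A = \sum_(j < n) ev c x A`_j * y ^+ j.
Proof.
by move=> An; rewrite ev2E (horner_map_sum _ _ An).
Qed.

Lemma ev2_inj (A : {poly {poly K}}) : (size A <= q)%N -> ev2 A = 0 -> A = 0.
Proof.
move=> Aq A0; apply/polyP => j; rewrite coef0; apply/eqP/negPn/negP => Aj0.
have jq : (j < q)%N.
  by rewrite ltnNge; apply: contra Aj0 => qj; rewrite nth_default // (leq_trans Aq).
(* The extra factor X makes the degree of a nonzero coefficient at least 1, so that the bound 0 on
   its weight is contradictory. *)
have := @weight_le_of_integral (fun j => A`_j * 'X) 0 _ j jq.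
rewrite mulf_neq0 ?polyX_eq0 // size_mulX // => H.
have : (q * size (A`_j)%R + d * j <= q * 0)%N.
  apply: H => //; rewrite expr0 mulr1.
  rewrite (eq_bigr (fun j : 'I_q => x * (ev c x A`_j * y ^+ j))) => [|i _].
    by rewrite -mulr_sumr -ev2_sum // A0 mulr0; exact: integral0.
  by rewrite rmorphM evX -mulrA mulrCA.
move: Aj0; rewrite -size_poly_gt0; nia.
Qed.

Lemma ev2_reduce (A : {poly {poly K}}) :
  exists2 B : {poly {poly K}}, (size B <= q)%N & ev2 B = ev2 A.
Proof.
pose P : {poly {poly K}} := 'X^q - ('X + f%:P).
have sr : (size ('X + f%:P : {poly {poly K}})%R < size ('X^q : {poly {poly K}})%R)%N.
  by rewrite size_polyXn size_XaddC.
have Pm : P \is monic by rewrite monicE /P lead_coefDl ?size_polyN // lead_coefXn.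
have P0 : ev2 P = 0.
  by rewrite /P rmorphB rmorphD rmorphXn ev2C ev2X -y_AS; ring.
exists (Pdiv.Ring.rmodp A P).
  rewrite -ltnS; have := Pdiv.Ring.ltn_rmodpN0 A (monic_neq0 Pm).
  by rewrite [size P]size_polyDl ?size_polyN // size_polyXn.
by rewrite [in RHS](Pdiv.RingMonic.rdivp_eq Pm A) rmorphD rmorphM P0 mulr0 add0r.
Qed.

Lemma integral_ev2 A : integralOver (ev c x) (ev2 A).
Proof.
rewrite (ev2_sum (leqnn _)); apply: integral_sum => j _; apply: integral_mul.
  exact: integral_id.
apply: integral_exp; apply: (@integral_trinomial_root _ _ _ q 1 (ev c x f)) => //.
- exact: integral1.
- exact: integral_id.
by rewrite mul1r.
Qed.

(* [(sum_j A_j y^j)^q = sum_j A_j^q (y + f)^j], and [Y -> Y + f] is invertible. *)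
Lemma ev2_frobenius_dvd (g : {poly K}) (A B : {poly {poly K}}) :
  irreducible_poly g -> (size A <= q)%N -> ev2 A ^+ q = ev c x g * ev2 B ->
  forall j, g %| A`_j.
Proof.
move=> gi Aq; have [B' B'q <-] := ev2_reduce B => AB j.
have [qj|jq] := leqP q j; first by rewrite nth_default ?dvdp0 // (leq_trans Aq).
pose FA : {poly {poly K}} := \poly_(j < q) (A`_j ^+ q).
(* Both sides have degree < q in Y and the same value at y, hence are equal as polynomials. *)
have E : FA \Po ('X + f%:P) = g%:P * B'.
  apply/eqP; rewrite -subr_eq0; apply/eqP/ev2_inj.
    apply: (leq_trans (size_polyD _ _)); rewrite geq_max size_polyN; apply/andP; split.
      by rewrite size_comp_poly2 ?size_XaddC ?size_poly.
    rewrite mul_polyC; exact: leq_trans (size_scale_leq _ _) B'q.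
  rewrite rmorphB rmorphM ev2C -AB; apply/eqP; rewrite subr_eq0; apply/eqP.
  rewrite (ev2_sum Aq) expr_pchar_sum // /FA poly_def linear_sum rmorph_sum.
  apply: eq_bigr => i _.
  rewrite -[X in ev2 X]/((A`_i ^+ q *: 'X^i) \Po ('X + f%:P)) comp_polyZ comp_Xn_poly.
  rewrite -mul_polyC rmorphM ev2C !rmorphXn rmorphD ev2C ev2X.
  rewrite exprMn; congr (_ * _); rewrite -exprM [(i * q)%N]mulnC exprM; congr (_ ^+ _).
  by rewrite -y_AS addrC subrK.
have : FA = g%:P * (B' \Po ('X - f%:P)).
  by rewrite -[LHS](comp_polyXaddC_K _ f) E comp_polyM comp_polyC.
move/(congr1 (fun p : {poly {poly K}} => p`_j)); rewrite coef_poly jq coefCM => Ej.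
by apply: (@irreducible_dvd_exp _ _ _ q gi); rewrite Ej dvdp_mulr.
Qed.

(** The q-th powers are peeled off one at a time, the degree in Y being reduced below q each time;
    so K[x, y] modulo g has no nilpotents. *)
Lemma ev2_frobenius_iter_dvd (g : {poly K}) N (A B : {poly {poly K}}) :
  irreducible_poly g -> (size A <= q)%N -> ev2 A ^+ (q ^ N) = ev c x g * ev2 B ->
  forall j, g %| A`_j.
Proof.
move=> gi; elim: N A B => [|N IH] A B Aq.
  have [B' B'q <-] := ev2_reduce B; rewrite expn0 expr1 -ev2C -rmorphM => AB.
  have -> : A = g%:P * B'.
    apply/eqP; rewrite -subr_eq0; apply/eqP/ev2_inj; last by rewrite rmorphB AB subrr.
    apply: (leq_trans (size_polyD _ _)); rewrite geq_max size_polyN Aq /=.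
    rewrite mul_polyC; exact: leq_trans (size_scale_leq _ _) B'q.
  by move=> j; rewrite coefCM dvdp_mulr.
rewrite expnS exprM -rmorphXn; have [A1 A1q A1E] := ev2_reduce (A ^+ q).
rewrite -A1E => /(IH _ _ A1q) /poly_dvd_coefs[B1 _ A1B].
by apply: (@ev2_frobenius_dvd _ _ B1) => //; rewrite -rmorphXn -A1E A1B rmorphM ev2C.
Qed.

(** Induction on the degree of D, removing an irreducible factor g: the integral equation of A / D,
    multiplied by D^m, shows that g divides a power of A, hence A itself. *)
Lemma integral_denominator_dvd (D : {poly K}) (A : {poly {poly K}}) :
  D != 0 -> (size A <= q)%N -> integralOver (ev c x) (ev2 A / ev c x D) ->
  forall j, D %| A`_j.
Proof.
have [n] := ubnP (size D); elim: n D A => // n IH D A; rewrite ltnS => Dn D0 Aq intA.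
have [D1|D1] := eqVneq (size D) 1%N.
  by move=> j; apply: dvdUp; rewrite -size_poly_eq1 D1.
have [|g gi gD] := @irreducible_factor_exists _ D.
  by move: D1 D0; rewrite -size_poly_gt0; case: (size D) => [|[|]].
have g0 := irredp_neq0 gi.
pose D' := D %/ g; have DE : D = D' * g by rewrite /D' divpK.
have D'0 : D' != 0 by apply: contraNneq D0; rewrite DE => ->; rewrite mul0r.
have evD0 p : p != 0 -> ev c x p != 0.
  by move=> p0; apply/eqP => /x_transc /eqP; rewrite (negPf p0).
have [N [B AB]] : exists N B, ev2 A ^+ (q ^ N) = ev c x g * ev2 B.
  case: (intA) => P Pm /rootP; rewrite (horner_map_sum _ _ (leqnn _)).
  have sP : size P = (size P).-1.+1 by rewrite prednK // size_poly_gt0 monic_neq0.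
  move: sP; set m := (size P).-1 => sP; rewrite sP big_ord_recr -[nat_of_ord ord_max]/m.
  rewrite (_ : P`_m = 1) ?rmorph1; last by rewrite -(monicP Pm).
  rewrite mul1r => H.
  have {}H : ev2 A ^+ m = ev c x g * ev2 (- \sum_(i < m) (D' * P`_i * D ^+ (m - i.+1))%:P * A ^+ i).
    have : ev c x D ^+ m * 0 = 0 by rewrite mulr0.
    rewrite -{1}H mulrDr expr_div_n mulrC -[X in _ + X]mulrC -mulrA mulVf ?expf_neq0 ?evD0 //.
    rewrite mulr1 addrC => /eqP; rewrite addr_eq0 => /eqP ->.
    rewrite rmorphN mulrN; congr (- _).
    rewrite rmorph_sum mulr_sumr mulr_suml; apply: eq_bigr => i _.
    rewrite -[nat_of_ord (widen_ord _ i)]/(nat_of_ord i) rmorphM ev2C !rmorphM !rmorphXn.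
    have -> : ev c x D ^+ m = ev c x D ^+ i * (ev c x D * ev c x D ^+ (m - i.+1)).
      by rewrite -exprS -exprD; congr (_ ^+ _); move: (ltn_ord i); lia.
    have ED : ev c x D = ev c x D' * ev c x g by rewrite DE rmorphM.
    rewrite expr_div_n.
    have : ev c x D ^+ i != 0 by rewrite expf_neq0 ?evD0.
    move: (ev c x D ^+ i) (ev2 A ^+ i) (ev c x D ^+ (m - i.+1)) => u v w u0.
    by rewrite ED; field.
  (* Since m <= q^m, a further power of A raises the exponent from m to q^m. *)
  exists m; exists ((- \sum_(i < m) (D' * P`_i * D ^+ (m - i.+1))%:P * A ^+ i) * A ^+ (q ^ m - m)).
  rewrite rmorphM mulrA -H rmorphXn -exprD subnKC // ltnW // ltn_expl //.
have [A' A'A AE] := poly_dvd_coefs (ev2_frobenius_iter_dvd gi Aq AB).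
move=> j; rewrite AE coefCM DE mulrC dvdp_mul2l //; apply: IH => //.
- apply: leq_trans Dn; rewrite [in X in (_ < X)%N]DE size_mul //; have [+ _] := gi.
  move: D'0; rewrite -size_poly_gt0; case: (size D') => // u _.
  by case: (size g) => [|[|v]] //= _; rewrite !addnS ltnS leq_addr.
- exact: leq_trans A'A Aq.
have -> : ev2 A' / ev c x D' = ev2 A / ev c x D; last by [].
rewrite AE DE !rmorphM ev2C; field; rewrite !evD0 //.
Qed.

Hypothesis frac_repr : forall z, exists D : {poly K}, exists A : {poly {poly K}},
  [/\ D != 0, (size A <= q)%N & z = ev2 A / ev c x D].

Lemma chart0_ev2 z : integralOver (ev c x) z ->
  exists2 A : {poly {poly K}}, (size A <= q)%N & z = ev2 A.
Proof.
have [D [A [D0 Aq ->]]] := frac_repr z => intz.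
have [A' A'A AE] := poly_dvd_coefs (integral_denominator_dvd D0 Aq intz).
exists A'; first exact: leq_trans A'A Aq.
rewrite AE rmorphM ev2C mulrAC divff ?mul1r //.
by apply/eqP => /x_transc /eqP; rewrite (negPf D0).
Qed.

(** A constant lies in K[x, y] and is integral at infinity, so all its monomials have weight <= 0,
    which leaves only the monomial 1. *)
Lemma full_constants z : algebraicOver c z -> exists a, z = c a.
Proof.
move=> za; have [A Aq zE] := chart0_ev2 (integral_ev_const x za).
have H := @weight_le_of_integral (fun j => A`_j) 0.
have {}H j : (j < q)%N -> A`_j != 0 -> (q * (size (A`_j)%R).-1 + d * j <= 0)%N.
  move=> jq Aj; rewrite -(muln0 q); apply: H => //.
  rewrite expr0 mulr1 -(ev2_sum Aq) -zE; exact: integral_ev_const.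
exists (A`_0)`_0; rewrite zE (ev2_sum Aq) (bigD1 (Ordinal (ltnW q_gt1))) //.
rewrite expr0 mulr1 big1 => [|j j0].
  rewrite [LHS]addr0; transitivity (ev c x A`_0) => //; rewrite -[RHS](evC c x); congr (ev c x _).
  apply: size1_polyC.
  have [->|/H] := eqVneq A`_0 0; first by rewrite size_poly0.
  by rewrite muln0 addn0 leqn0 muln_eq0 gtn_eqF ?(ltnW q_gt1) //= => /(_ isT)/eqP; lia.
have [->|/(H _ (ltn_ord j))] := eqVneq A`_j 0; first by rewrite rmorph0 mul0r.
have : (0 < j)%N by rewrite lt0n; apply: contra j0 => /eqP ?; apply/eqP/val_inj.
by nia.
Qed.

(** * A basis of H^1(O) from the gaps *)

Let gap_fun (k : 'I_#|gap_set q d|) : F :=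
  x^-1 ^+ (enum_val k).1.+1 * y ^+ (enum_val k).2.+1.

Lemma gap_fun_overlap k : exists n, integralOver (ev c x) (x ^+ n * gap_fun k).
Proof.
exists (enum_val k).1.+1; rewrite /gap_fun mulrA -exprMn divff // expr1n mul1r.
by rewrite -ev2X -rmorphXn; exact: integral_ev2.
Qed.

Let cech_split z (a : {ffun 'I_#|gap_set q d| -> K}) :=
  exists u v, [/\ integralOver (ev c x) u, intoo v &
                  z - \sum_k c (a k) * gap_fun k = u + v].

Lemma cech_split_sum I (r : seq I) (z : I -> F) :
  (forall i, exists a, cech_split (z i) a) ->
  exists a, cech_split (\sum_(i <- r) z i) a.
Proof.
move=> H; elim/big_rec: _ => [|i w _ [a [u [v [iu iv E]]]]].
  exists [ffun=> 0]; exists 0, 0; split; [exact: integral0|exact: integral0|].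
  by rewrite big1 ?subr0 ?addr0 // => k _; rewrite ffunE rmorph0 mul0r.
have [a' [u' [v' [iu' iv' E']]]] := H i.
exists [ffun k => a' k + a k]; exists (u' + u), (v' + v).
split; [exact: integral_add|exact: integral_add|].
rewrite (eq_bigr (fun k => c (a' k) * gap_fun k + c (a k) * gap_fun k)) => [|k _].
  by rewrite big_split /= opprD addrACA E E' addrACA.
by rewrite ffunE rmorphD mulrDl.
Qed.

(** Three cases for x^(i-n) y^j: if i >= n it is regular on the finite chart; if its weight is <= 0
    it is regular at infinity; otherwise it is a gap function. *)
Lemma cech_split_monomial b i n j : (j < q)%N ->
  exists a, cech_split (c b * x ^+ i * x^-1 ^+ n * y ^+ j) a.
Proof.
move=> jq; have sum0 : \sum_k c ([ffun=> 0] k) * gap_fun k = 0.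
  by rewrite big1 // => k _; rewrite ffunE rmorph0 mul0r.
have [ni|ni] := leqP n i.
  exists [ffun=> 0]; exists (c b * x ^+ i * x^-1 ^+ n * y ^+ j), 0.
  split; [|exact: integral0|by rewrite sum0 subr0 addr0].
  rewrite -(mulrA (c b)) expr_cancelXV //.
  have -> : c b * x ^+ (i - n) * y ^+ j = ev2 ((b *: 'X^(i - n))%:P * 'X^j).
    by rewrite rmorphM ev2C rmorphXn ev2X -mul_polyC rmorphM evC rmorphXn evX.
  exact: integral_ev2.
have E : c b * x ^+ i * x^-1 ^+ n * y ^+ j = c b * (x^-1 ^+ (n - i) * y ^+ j).
  by rewrite -(mulrA (c b)) expr_cancelV ?mulrA // ltnW.
have [le|gt] := leqP (d * j) (q * (n - i)).
  exists [ffun=> 0]; exists 0, (c b * x ^+ i * x^-1 ^+ n * y ^+ j).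
  split; [exact: integral0| |by rewrite sum0 subr0 add0r].
  rewrite E; apply: integral_mul; first exact: integral_cst.
  by rewrite mulrC; exact: integral_y_power.
have ad : ((n - i).-1 < d.-1)%N by nia.
have jq' : (j.-1 < q.-1)%N by nia.
pose p := (Ordinal ad, Ordinal jq').
have pa : (p.1.+1 = n - i)%N by rewrite /=; lia.
have pj : (p.2.+1 = j)%N by rewrite /= prednK // lt0n; apply: contraTneq gt => ->; rewrite muln0.
have pG : p \in gap_set q d by rewrite inE pa pj.
exists [ffun k => if k == enum_rank_in pG p then b else 0]; exists 0, 0.
split; [exact: integral0|exact: integral0|].
rewrite (bigD1 (enum_rank_in pG p)) // big1 => [|k /negPf kp].
  by rewrite ffunE eqxx /gap_fun enum_rankK_in // pa pj E [X in _ - X]addr0 subrr addr0.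
by rewrite ffunE kp rmorph0 mul0r.
Qed.

Lemma cech_split_exists z : (exists n, integralOver (ev c x) (x ^+ n * z)) ->
  exists a, cech_split z a.
Proof.
move=> [n /chart0_ev2[A Aq zE]].
have -> : z = \sum_(j < q) \sum_(i < size A`_j)
    c (A`_j)`_i * x ^+ i * x^-1 ^+ n * y ^+ j.
  rewrite (_ : z = ev2 A * x^-1 ^+ n); last first.
    by rewrite -zE mulrAC -exprMn divff // expr1n mul1r.
  rewrite (ev2_sum Aq) mulr_suml; apply: eq_bigr => j _.
  by rewrite (ev_sum _ _ (leqnn _)) mulrAC !mulr_suml.
apply: cech_split_sum => j; apply: cech_split_sum => i.
exact: cech_split_monomial.
Qed.

(** For two splittings, v' - v is integral at infinity and equals a combination of gap functions
    minus an element of K[x, y]; a nonzero coefficient in the combination would give it positive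
    weight. *)
Lemma cech_split_unique z a a' : cech_split z a -> cech_split z a' -> a = a'.
Proof.
move=> [u [v [iu iv E]]] [u' [v' [iu' iv' E']]].
apply/ffunP => k0; apply/eqP; rewrite -subr_eq0; apply/negPn/negP => b0.
pose b k := a k - a' k.
have j2q (k : 'I_#|gap_set q d|) : ((enum_val k).2.+1 < q)%N.
  by move: (ltn_ord (enum_val k).2); lia.
have [U Uq UE] := chart0_ev2 (integral_sub iu' iu).
(* The coefficient of y^j in x^d (v' - v): the gap terms have degree < d in x, while the part from
   K[x, y] starts in degree d, so they cannot interfere. *)
pose V (j : nat) := \sum_(k : 'I_#|gap_set q d| | (enum_val k).2.+1 == j)
     b k *: 'X^(d - (enum_val k).1.+1)
   - U`_j * 'X^d.
have vE : (\sum_(j < q) ev c x (V j) * y ^+ j) * x^-1 ^+ d = v' - v.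
  have -> : v' - v = \sum_k c (b k) * gap_fun k - (u' - u).
    rewrite (eq_bigr (fun k => c (a k) * gap_fun k - c (a' k) * gap_fun k)) => [|k _].
      have -> : v = z - \sum_k c (a k) * gap_fun k - u by rewrite E; ring.
      have -> : v' = z - \sum_k c (a' k) * gap_fun k - u' by rewrite E'; ring.
      by rewrite sumrB; ring.
    by rewrite /b rmorphB mulrBl.
  rewrite UE (ev2_sum Uq).
  rewrite (eq_bigr (fun j : 'I_q =>
    (\sum_(k : 'I_#|gap_set q d| | (enum_val k).2.+1 == j) c (b k) * gap_fun k - ev c x U`_j * y ^+ j) * x ^+ d)).
    by rewrite -mulr_suml -mulrA -exprMn divff // expr1n mulr1 sumrB; congr (_ - _);
       rewrite [RHS](partition_big (fun k => Ordinal (j2q k)) predT).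
  move=> j _; rewrite /V rmorphB rmorphM rmorphXn evX rmorph_sum !mulrBl; congr (_ - _); last ring.
  rewrite !mulr_suml; apply: eq_bigr => k /eqP kj.
  rewrite -mul_polyC rmorphM evC rmorphXn evX /gap_fun kj -!mulrA; congr (_ * _).
  rewrite mulrA [RHS]mulrC mulrA expr_cancelXV //.
  by move: (ltn_ord (enum_val k).1); lia.
pose j0 := (enum_val k0).2.+1; pose i0 := (d - (enum_val k0).1.+1)%N.
have j0q : (j0 < q)%N by move: (ltn_ord (enum_val k0).2); rewrite /j0; lia.
have i0d : (i0 < d)%N by rewrite /i0; lia.
have Vi0 : (V j0)`_i0 = b k0.
  rewrite /V coefB coefMXn i0d subr0 coef_sum (bigD1 k0) //= coefZ coefXn eqxx mulr1.
  rewrite big1 ?addr0 // => k /andP[kj kk0]; rewrite coefZ coefXn.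
  case: eqP => [i0E|]; last by rewrite mulr0.
  case/eqP: kk0; apply: enum_val_inj; move: kj i0E; rewrite /i0 /j0.
  case: (enum_val k) => a1 j1; case: (enum_val k0) => a2 j2 /= /eqP[j12] a12.
  congr (_, _); apply: val_inj => //=; move: (ltn_ord a1) (ltn_ord a2); lia.
have V0 : V j0 != 0 by apply: contraNneq b0 => V0; rewrite -/(b k0) -Vi0 V0 coef0.
have := @weight_le_of_integral V d.
rewrite vE => /(_ (integral_sub iv' iv) j0 j0q V0).
have sV : (i0 < size (V j0))%N.
  by rewrite ltnNge; apply: contra b0 => sV; rewrite -/(b k0) -Vi0 nth_default.
have := enum_valP k0; rewrite inE -/j0.
move: sV; rewrite /i0; move: (ltn_ord (enum_val k0).1); move: (size _) (nat_of_ord _) => s a1.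
case: s => // s /=; nia.
Qed.

End ArtinSchreierPlace.

(** * The function field *)

Lemma fraction_denominator (R : idomainType) (a : {fraction R}) :
  exists D n : R, D != 0 /\ tofrac D * a = tofrac n.
Proof.
elim/quotW: a => r; exists (\d_r), (\n_r); split; first exact: denom_ratioP.
unlock tofrac; rewrite -[LHS]FracField.pi_mul; apply/eqmodP => /=.
rewrite FracField.equivfE /= /FracField.mulf /= !numden_Ratio ?mulf_neq0 ?oner_eq0 ?denom_ratioP //.
by rewrite !mul1r mulr1.
Qed.

Lemma poly_fraction_denominator (R : idomainType) (p : {poly {fraction R}}) :
  exists D (A : {poly R}), D != 0 /\ (tofrac D)%:P * p = map_poly (@FracField.tofrac R) A.
Proof.
elim/poly_ind: p => [|p a [D [A [D0 E]]]].
  by exists 1, 0; rewrite oner_eq0 rmorph0 mulr0.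
have [d [n [d0 En]]] := fraction_denominator a.
exists (D * d), (d *: (A * 'X) + (D * n)%:P); split; first exact: mulf_neq0.
rewrite -mul_polyC rmorphD !rmorphM /= map_polyX !map_polyC -E.
transitivity ((tofrac d)%:P * ((tofrac D)%:P * p * 'X) + (tofrac D)%:P * (tofrac n)%:P) => //.
by rewrite -En polyCM mulrDr -!mulrA [in LHS]mulrCA.
Qed.

Section FunctionFieldEval.

Variables (K : finFieldType) (F : fieldExtType {fraction {poly K}}).

(** The map [ff_const] as a ring morphism, so that the preceding results apply to F. *)
Definition ff_cst : {rmorphism K -> F} :=
  (in_alg F \o (@FracField.tofrac _ \o polyC) : {rmorphism K -> F}).

Lemma ff_cstE a : ff_cst a = ff_const F a. Proof. by []. Qed.

Lemma ev_ff_x (p : {poly K}) : ev ff_cst (ff_x F) p = (tofrac p)%:A.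
Proof.
elim/poly_ind: p => [|p a IH]; first by rewrite !rmorph0 scale0r.
by rewrite !rmorphD !rmorphM evX evC IH scalerDl -scalerAl mul1r scalerA.
Qed.

Lemma ff_x_transc (p : {poly K}) : ev ff_cst (ff_x F) p = 0 -> p = 0.
Proof.
move=> /eqP; rewrite ev_ff_x -[_%:A]/(in_alg F _) fmorph_eq0 tofrac_eq0.
by move/eqP.
Qed.

Lemma chart0E z : integralOver (ev ff_cst (ff_x F)) z = chart0 z.
Proof. by []. Qed.

Lemma chartooE z : integralOver (ev ff_cst (ff_x F)^-1) z = chartoo z.
Proof. by []. Qed.

End FunctionFieldEval.

Lemma size_AS_poly (K : finFieldType) q (f : {poly K}) :
  (1 < q)%N -> size (AS_poly q f) = q.+1.
Proof.
move=> q1; rewrite /AS_poly -addrA -opprD size_polyDl ?size_polyXn //.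
by rewrite size_polyN size_XaddC.
Qed.

Section ArtinSchreierFunctionField.

Variables (K : finFieldType) (F : fieldExtType {fraction {poly K}}).
Variables (q d : nat) (f : {poly K}) (y : F).
Hypothesis q_pchar : [pchar K].-nat q.
Hypothesis q_gt1 : (1 < q)%N.
Hypothesis d_gt1 : (1 < d)%N.
Hypothesis coprime_qd : coprime q d.
Hypothesis size_f : size f = d.+1.
Hypothesis y_AS : y ^+ q - y = (tofrac f)%:A.
Hypothesis y_gen : <<1; y>>%VS = fullv.

Local Notation c := (ff_cst F).
Local Notation x := (ff_x F).

Lemma ff_pchar : [pchar F].-nat q.
Proof. by rewrite (eq_pnat _ (fmorph_pchar c)). Qed.

Lemma ff_y_AS : y ^+ q - y = ev c x f.
Proof. by rewrite ev_ff_x. Qed.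

Lemma horner_alg_ev2 D (A : {poly {poly K}}) (p : {poly {fraction {poly K}}}) :
  (tofrac D)%:P * p = map_poly (@FracField.tofrac _) A ->
  ev c x D * (map_poly (in_alg F) p).[y] = ev2 c x y A.
Proof.
move=> E; rewrite ev_ff_x.
have <- : (map_poly (in_alg F) ((tofrac D)%:P * p)).[y] =
    (tofrac D)%:A * (map_poly (in_alg F) p).[y].
  by rewrite rmorphM hornerM /= map_polyC hornerC.
rewrite E -map_poly_comp ev2E; congr (_.[y]).
by apply: eq_map_poly => p'; rewrite ev_ff_x.
Qed.

(** Clearing denominators reduces this to the injectivity of evaluation in Y-degree < q; hence y has
    degree at least q over K(x). *)
Lemma ff_indep (p : {poly {fraction {poly K}}}) :
  (size p <= q)%N -> (map_poly (in_alg F) p).[y] = 0 -> p = 0.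
Proof.
move=> pq py; have [D [A [D0 E]]] := poly_fraction_denominator p.
have sA : size A = size p.
  have : size ((tofrac D)%:P * p) = size (map_poly (@FracField.tofrac _) A) by rewrite E.
  rewrite size_map_inj_poly ?tofrac0 // => [<-|u v /eqP].
    by rewrite mul_polyC size_scale // tofrac_eq0.
  by rewrite tofrac_eq => /eqP.
have A0 : A = 0.
  apply: (ev2_inj (@ff_x_transc _ F) ff_pchar q_gt1 d_gt1 coprime_qd size_f ff_y_AS).
    by rewrite sA.
  by rewrite -(horner_alg_ev2 E) py mulr0.
by apply/eqP; rewrite -size_poly_eq0 -sA A0 size_poly0.
Qed.

Lemma ff_frac_repr z : exists D : {poly K}, exists A : {poly {poly K}},
  [/\ D != 0, (size A <= q)%N & z = ev2 c x y A / ev c x D].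
Proof.
have : z \in <<1; y>>%VS by rewrite y_gen memvf.
case/Fadjoin1_polyP => p zE; have [D [A [D0 E]]] := poly_fraction_denominator p.
have [A' A'q A'E] := ev2_reduce q_gt1 ff_y_AS A.
exists D, A'; split=> //.
rewrite A'E -(horner_alg_ev2 E) -zE mulrC mulKf //.
by apply/eqP => /ff_x_transc /eqP; rewrite (negPf D0).
Qed.

Lemma ff_full_constants : full_constant_field F.
Proof.
move=> z za; have za' : algebraicOver c z by exact: za.
have [a ->] := full_constants (@ff_x_transc _ F) ff_pchar q_gt1 d_gt1 coprime_qd size_f
  ff_y_AS ff_frac_repr za'.
by exists a.
Qed.

Lemma ff_gap_overlap (k : 'I_#|gap_set q d|) : exists n, integralOver (ev c x)
  (x ^+ n * (x^-1 ^+ (enum_val k).1.+1 * y ^+ (enum_val k).2.+1)).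
Proof. exact: (gap_fun_overlap (@ff_x_transc _ F) q_gt1 ff_y_AS). Qed.

Lemma ff_cech_exists (z : F) : (exists n, integralOver (ev c x) (x ^+ n * z)) ->
  exists a : {ffun 'I_#|gap_set q d| -> K}, exists u v : F,
   [/\ integralOver (ev c x) u, integralOver (ev c x^-1) v &
      z - \sum_k c (a k) * (x^-1 ^+ (enum_val k).1.+1 * y ^+ (enum_val k).2.+1) = u + v].
Proof. exact: (cech_split_exists (@ff_x_transc _ F) ff_pchar q_gt1 d_gt1 coprime_qd
  size_f ff_y_AS ff_frac_repr). Qed.

Lemma ff_cech_unique (z : F) (a a' : {ffun 'I_#|gap_set q d| -> K}) :
  (exists u v : F, [/\ integralOver (ev c x) u, integralOver (ev c x^-1) v &
      z - \sum_k c (a k) * (x^-1 ^+ (enum_val k).1.+1 * y ^+ (enum_val k).2.+1) = u + v]) ->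
  (exists u v : F, [/\ integralOver (ev c x) u, integralOver (ev c x^-1) v &
      z - \sum_k c (a' k) * (x^-1 ^+ (enum_val k).1.+1 * y ^+ (enum_val k).2.+1) = u + v]) ->
  a = a'.
Proof. exact: (cech_split_unique (@ff_x_transc _ F) ff_pchar q_gt1 d_gt1 coprime_qd
  size_f ff_y_AS ff_frac_repr). Qed.

Lemma overlapE (z : F) : overlap z <-> (exists n, integralOver (ev c x) (x ^+ n * z)).
Proof. by split=> -[n H]; exists n; move: H; rewrite chart0E. Qed.

Lemma cech_splitE (e : 'I_#|gap_set q d| -> F) z (a : {ffun 'I_#|gap_set q d| -> K}) :
  (exists u v : F, [/\ chart0 u, chartoo v & z - \sum_k ff_const F (a k) * e k = u + v]) <->
  (exists u v : F, [/\ integralOver (ev c x) u, integralOver (ev c x^-1) v &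
      z - \sum_k c (a k) * e k = u + v]).
Proof.
have sumE : \sum_k ff_const F (a k) * e k = \sum_k c (a k) * e k.
  by apply: eq_bigr => k _; rewrite ff_cstE.
rewrite sumE.
split=> -[u [v [iu iv E]]]; exists u, v.
  split; [by rewrite chart0E|by rewrite chartooE|exact E].
split; [by rewrite -chart0E|by rewrite -chartooE|exact E].
Qed.

Lemma ff_has_genus : has_genus F #|gap_set q d|.
Proof.
exists (fun k : 'I_#|gap_set q d| => x^-1 ^+ (enum_val k).1.+1 * y ^+ (enum_val k).2.+1); split.
  by move=> k; apply/overlapE; exact: ff_gap_overlap.
move=> z /overlapE zo; have [a za] := ff_cech_exists zo.
exists a; split; first by apply/cech_splitE; exact za.
move=> a' /cech_splitE za'.
exact (ff_cech_unique za za').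
Qed.

End ArtinSchreierFunctionField.

(** A root of an irreducible factor g of Y^q - Y - f has degree at least q over K(x), so g is Y^q -
    Y - f up to a scalar, and adjoining the root yields F. *)
Lemma AS_function_field_exists (K : finFieldType) q d (f : {poly K}) :
  [pchar K].-nat q -> (1 < q)%N -> (1 < d)%N -> coprime q d -> size f = d.+1 ->
  exists F : fieldExtType {fraction {poly K}},
    AS_function_field q f F /\ has_genus F #|gap_set q d|.
Proof.
move=> qp q1 d1 cop sf; have sP := size_AS_poly f q1.
have [|g gi gP] := @irreducible_factor_exists _ (AS_poly q f).
  by rewrite sP ltnS ltnW.
have [F _ [y gy y_gen]] := irredp_FAdjoin gi.
have y_AS : y ^+ q - y = (tofrac f)%:A.
  have : root (map_poly (in_alg F) (AS_poly q f)) y.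
    by case/dvdpP: gP => r ->; rewrite rmorphM rootM gy orbT.
  rewrite /root /AS_poly !rmorphB rmorphXn /= map_polyX map_polyC !hornerE.
  by rewrite subr_eq0 => /eqP.
have sg : (q < size g)%N.
  rewrite ltnNge; apply/negP => gq; have := irredp_neq0 gi.
  by rewrite (ff_indep qp q1 d1 cop sf y_AS gq (rootP gy)) eqxx.
have gPe : g %= AS_poly q f.
  rewrite -dvdp_size_eqp // eqn_leq dvdp_leq // ?sP //.
  by rewrite -size_poly_gt0 sP.
exists F; split; last exact: (ff_has_genus qp q1 d1 cop sf y_AS y_gen).
split; [|exact: (ff_full_constants qp q1 d1 cop sf y_AS y_gen)|by exists y].
split=> [|r r1 rP]; first by rewrite sP ltnS ltnW.
by rewrite (eqp_trans _ gPe) // gi // (eqp_dvdr _ gPe).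
Qed.

(** * The trace form *)

Lemma periodic_sum_shift (V : zmodType) (g : nat -> V) n l :
  (forall j, g (j + n)%N = g j) -> \sum_(j < n) g (j + l)%N = \sum_(j < n) g j.
Proof.
move=> gn; elim: l => [|l <-]; first by apply: eq_bigr => j _; rewrite addn0.
case: n gn => [|n] gn; first by rewrite !big_ord0.
rewrite [in RHS]big_ord_recl [in LHS]big_ord_recr /= addrC; congr (_ + _).
  by rewrite addnS -addSn addnC gn.
by apply: eq_bigr => j _; rewrite addnS.
Qed.

Lemma sum_ord_rev (V : zmodType) (g : nat -> V) n :
  \sum_(l < n) g (n - l.+1)%N = \sum_(l < n) g l.
Proof. by rewrite -(big_mkord predT g) big_rev_mkord subn0. Qed.

(* The products [v_j v_(j+l)] and [v_j v_(j-l)] have the same cyclic sum. *)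
Lemma periodic_sum_square (R : comNzRingType) (v : nat -> R) h :
  (forall j, v (j + h.*2.+1)%N = v j) ->
  \sum_(j < h.*2.+1) v j * (v j + 2 * \sum_(l < h) v (j + l.+1)%N) =
  (\sum_(j < h.*2.+1) v j) ^+ 2.
Proof.
move=> vp; set m := h.*2.+1; pose c l := \sum_(j < m) v j * v (j + l)%N.
have -> : (\sum_(j < m) v j) ^+ 2 = \sum_(l < m) c l.
  rewrite /c exchange_big expr2 mulr_suml; apply: eq_bigr => j _.
  rewrite -mulr_sumr -(periodic_sum_shift j vp); congr (_ * _).
  by apply: eq_bigr => l _; rewrite addnC.
have cC l : (l <= m)%N -> c (m - l)%N = c l.
  move=> lm; rewrite /c -(@periodic_sum_shift _ (fun j => v j * v (j + (m - l))%N) _ l).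
    apply: eq_bigr => j _; rewrite mulrC; congr (_ * _).
    by rewrite -addnA subnKC // vp.
  by move=> j; rewrite vp addnAC vp.
(* As m = 2 h + 1, the nonzero shifts pair off as l and m - l. *)
have -> : \sum_(l < m) c l = c 0%N + (\sum_(l < h) c l.+1 + \sum_(l < h) c l.+1).
  rewrite big_ord_recl; congr (_ + _).
  rewrite -(big_mkord predT (fun i => c i.+1)) (@big_cat_nat _ _ _ h) //=; last by lia.
  rewrite big_mkord; congr (_ + _).
  rewrite -{1}[h]add0n big_addn -addnn addnK big_mkord -[RHS](sum_ord_rev (fun l => c l.+1)).
  apply: eq_bigr => l _; have lh := ltn_ord l; rewrite -cC; last by rewrite /m; lia.
  by congr c; rewrite /m; lia.
have -> : \sum_(l < h) c l.+1 = \sum_(j < m) v j * \sum_(l < h) v (j + l.+1)%N.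
  by rewrite /c exchange_big; apply: eq_bigr => j _; rewrite mulr_sumr.
rewrite /c -!big_split /=; apply: eq_bigr => j _.
by rewrite addn0; ring.
Qed.

Lemma sum_ord_double (V : nmodType) (g : nat -> V) h :
  \sum_(i < h.*2) g i = \sum_(l < h) (g l.*2 + g l.*2.+1).
Proof.
by elim: h => [|h IH]; rewrite ?big_ord0 // doubleS !big_ord_recr /= IH addrA.
Qed.

(** * Finite fields: characteristic, squares, dimension bounds *)

Lemma finField_card_pchar (k : finFieldType) : [pchar k].-nat #|k|.
Proof.
have [p p_pr pk] := finPcharP k.
rewrite (eq_pnat _ (pcharf_eq pk)) -cardsT.
exact: (@pprimeChar_pgroup p k pk).
Qed.

(** Euler's criterion: the hypothesis makes X^2 - a divide X^N - X, which splits over K. *)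
Lemma finField_sqrt (K : finFieldType) (a : K) :
  odd #|K| -> a ^+ (#|K|.-1)./2 = 1 -> exists b, b ^+ 2 = a.
Proof.
move=> oK aN; set N := #|K| in oK aN *.
have N1 : (1 < N)%N := finNzRing_gt1 K.
have NE : N.-1 = (N.-1)./2.*2 by rewrite -[LHS]odd_double_half; case: (N) N1 oK => // n _ /= /negPf->.
have dvdP : 'X^2 - a%:P %| \prod_(x <- enum K) ('X - x%:P).
  rewrite big_enum /= -finField_genPoly -/N.
  have -> : 'X^N - 'X = 'X * (('X^2) ^+ (N.-1)./2 - (a%:P) ^+ (N.-1)./2) :> {poly K}.
    rewrite -polyC_exp aN -exprM mul2n -NE mulrBr mulr1 -exprS prednK // ltnW //.
  by rewrite subrXX mulrCA dvdp_mulr.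
have [s E] := dvdp_prod_XsubC dvdP.
have : size ('X^2 - a%:P : {poly K}) = 3 by rewrite size_XnsubC.
rewrite (eqp_size E) size_prod_XsubC; case: (mask _ _) E => // b r E _.
exists b; apply/eqP; rewrite -subr_eq0.
have : root ('X^2 - a%:P) b.
  by rewrite (eqp_root E) root_prod_XsubC mem_head.
by rewrite /root !hornerE.
Qed.

Lemma dim_le_of_roots (k : finFieldType) (L : fieldExtType k) (V : {vspace L})
    (p : {poly L}) n :
  p != 0 -> (size p <= (#|k| ^ n).+1)%N -> (forall v, v \in V -> p.[v] = 0) ->
  (\dim V <= n)%N.
Proof.
move=> p0 sp pV; rewrite -(leq_exp2l _ _ (finNzRing_gt1 k)) -ltnS.
rewrite -(@card_vspace k (finvect_type L) _ V) cardE; apply: leq_trans sp.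
apply: max_poly_roots; [exact: p0| |exact: enum_uniq].
by apply/allP => v; rewrite mem_enum => /pV /rootP.
Qed.

(** * Powers of the Frobenius and the trace *)

Section FrobeniusPowers.

Variables (k : finFieldType) (L : splittingFieldType k) (q n : nat).
Hypothesis card_k : #|k| = q.
Hypothesis dim_L : \dim {:L} = n.

Lemma base_gt1 : (1 < q)%N.
Proof. by rewrite -card_k finNzRing_gt1. Qed.

Lemma ext_pchar i : [pchar L].-nat (q ^ i)%N.
Proof.
by rewrite pnatX (eq_pnat _ (fmorph_pchar (in_alg L))) -card_k finField_card_pchar.
Qed.

Lemma frobD i (u v : L) : (u + v) ^+ (q ^ i) = u ^+ (q ^ i) + v ^+ (q ^ i).
Proof. exact: exprDn_pchar (ext_pchar i). Qed.

Lemma frob_nat i r : (r%:R : L) ^+ (q ^ i) = r%:R.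
Proof.
by elim: r => [|r IH]; rewrite ?expr0n ?expn_eq0 ?gtn_eqF ?(ltnW base_gt1) //;
   rewrite -addn1 natrD frobD IH expr1n.
Qed.

Lemma frob_sum i I (r : seq I) (P : pred I) (a : I -> L) :
  (\sum_(j <- r | P j) a j) ^+ (q ^ i) = \sum_(j <- r | P j) a j ^+ (q ^ i).
Proof. exact: expr_pchar_sum (ext_pchar i). Qed.

Lemma frobZ i (a : k) (u : L) : (a *: u) ^+ (q ^ i) = a *: u ^+ (q ^ i).
Proof.
rewrite exprZn; congr (_ *: _); elim: i => [|i IH]; first by rewrite expr1.
by rewrite expnSr exprM IH -card_k expf_card.
Qed.

Lemma frob_comp i j (u : L) : (u ^+ (q ^ i)) ^+ (q ^ j) = u ^+ (q ^ (i + j)).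
Proof. by rewrite -exprM expnD. Qed.

Lemma frob_full (u : L) : u ^+ (q ^ n) = u.
Proof.
apply/eqP; rewrite -card_k -dim_L -(Fermat's_little_theorem {:L}%AS); exact: memvf.
Qed.

Lemma frob_period i (u : L) : u ^+ (q ^ (i + n)) = u ^+ (q ^ i).
Proof. by rewrite -frob_comp frob_full. Qed.

(** The Galois group is cyclic of order n, generated by u -> u^q. *)
Lemma galTrace_frob (u : L) : galTrace 1 {:L} u = \sum_(i < n) u ^+ (q ^ i).
Proof.
have [al gen alE] := finField_galois_generator (sub1v {:L}%AS).
have G : 'Gal({:L} / 1)%g = <[al]>%g by apply/eqP.
have alX i : (al ^+ i)%g u = u ^+ (q ^ i).
  elim: i => [|i IH]; first by rewrite expg0 gal_id expr1.
  rewrite expgSr galM ?memvf // IH alE ?memvf // dimv1 expn1 card_k.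
  by rewrite -exprM expnSr.
have oal : #[al]%g = n.
  rewrite orderE -G -(galois_dim (finField_galois (sub1v {:L}%AS))) dimv1 divn1 //.
have uniq_al : uniq [seq (al ^+ i)%g | i <- iota 0 n].
  rewrite map_inj_in_uniq ?iota_uniq // => i j; rewrite !mem_iota !add0n => lti ltj.
  by move/eqP; rewrite eq_expg_mod_order oal !modn_small // => /eqP.
rewrite /galTrace G -(big_mkord predT (fun i => u ^+ (q ^ i))) /index_iota subn0.
rewrite (eq_bigr (fun i => (al ^+ i)%g u)) => [|i _]; last by rewrite alX.
transitivity (\sum_(x <- [seq (al ^+ i)%g | i <- iota 0 n]) x u); last by rewrite big_map.
rewrite big_uniq //.
apply: eq_bigl => x; apply/idP/mapP => [/cyclePmin[i]|[i _ ->]]; last exact: mem_cycle.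
by rewrite oal => lti ->; exists i; rewrite ?mem_iota.
Qed.

End FrobeniusPowers.

(** * The form Tr(x S(x)) and its radical *)

Section TraceForm.

Variables (k : finFieldType) (L : splittingFieldType k) (q h : nat).
Hypothesis card_k : #|k| = q.
Hypothesis q_mod4 : q = 1 %[mod 4].
Let m := h.*2.+1.
Hypothesis dim_L : \dim {:L} = (2 * m)%N.
Variables (s : nat -> L) (S : {poly L}) (b : L).
Hypothesis b_sqr : b ^+ 2 = s 0%N.
Hypothesis b_neq0 : b != 0.
Hypothesis s_pos : forall i, (1 <= i)%N -> (i < m)%N ->
  s i = if odd i then 0 else 2 * s 0%N ^+ ((q ^ i + 1) %/ 2).
Hypothesis S_def : S = \sum_(i < m) s i *: 'X^(q ^ i).

Let q_gt1 : (1 < q)%N := base_gt1 card_k.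

Lemma odd_q : odd q.
Proof. by have := divn_eq q 4; rewrite q_mod4 => ->; rewrite oddD oddM andbF. Qed.

Lemma two_neq0 : (2 : L) != 0.
Proof.
have [p p_pr pL] := finPcharP (FinFieldExtType L).
apply/eqP => H; have p2 : 2 \in [pchar L] by rewrite inE /= H eqxx.
have := ext_pchar L card_k 1; rewrite expn1 (eq_pnat _ (pcharf_eq p2)).
by case/p_natP => -[|i] E; [move: q_gt1; rewrite E|move: odd_q; rewrite E oddX].
Qed.

(* Up to the substitution [x -> b x], the trace to the field with [q^2] elements. *)
Definition half_trace (x : L) : L := \sum_(j < m) (b * x) ^+ (q ^ j.*2).

Lemma half_trace_linear : linear half_trace.
Proof.
move=> a u v; rewrite /half_trace scaler_sumr -big_split; apply: eq_bigr => j _ /=.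
by rewrite mulrDr (frobD card_k) -scalerAr (frobZ card_k).
Qed.

HB.instance Definition _ := GRing.isLinear.Build k L L *:%R half_trace half_trace_linear.

Let v x j := (b * x) ^+ (q ^ j.*2).

Let v_period x j : v x (j + m) = v x j.
Proof. by rewrite /v doubleD -(mul2n m) (frob_period card_k dim_L). Qed.

Lemma half_trace_fixed x : half_trace x ^+ (q ^ 2) = half_trace x.
Proof.
rewrite /half_trace (frob_sum card_k) -[RHS](periodic_sum_shift 1 (v_period x)).
by apply: eq_bigr => j _; rewrite frob_comp /v addn1 doubleS addn2.
Qed.

(** With s_0 = b^2 and q odd, s_i = 2 b^(q^i + 1) for even i > 0, so s_i x^(q^i + 1) = 2 (b x) (b
    x)^(q^i); the terms with odd i vanish. *)
Lemma linearized_product x : x * S.[x] = v x 0 * (v x 0 + 2 * \sum_(l < h) v x l.+1).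
Proof.
have v0 : v x 0 = b * x by rewrite /v expr1.
rewrite S_def horner_sum (eq_bigr (fun i : 'I_m => s i * x ^+ (q ^ i))) => [|i _].
  rewrite big_ord_recl (sum_ord_double (fun i => s i.+1 * x ^+ (q ^ i.+1))) -b_sqr expr1.
  rewrite mulrDr [RHS]mulrDr v0; congr (_ + _); first by ring.
  rewrite mulr_sumr mulr_sumr mulr_sumr; apply: eq_bigr => l _.
  have lh := ltn_ord l.
  have -> : s l.*2.+1 = 0.
    by rewrite s_pos; [rewrite oddS odd_double| |rewrite /m; lia].
  have -> : s l.*2.+2 = 2 * b ^+ (q ^ l.*2.+2).+1.
    rewrite s_pos; [rewrite !oddS odd_double negbK| |rewrite /m; lia]; last by [].
    rewrite -b_sqr -exprM addn1 divn2 mul2n even_halfK //.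
    by rewrite oddS oddX odd_q orbT.
  by rewrite /v doubleS exprS exprMn; ring.
by rewrite hornerZ hornerXn.
Qed.

(** Among the 2m conjugates in the trace, those with even exponent sum to t^2 by
    [periodic_sum_square]; those with odd exponent are their q-th powers. *)
Lemma trace_form_half_trace x :
  trace_form S x = half_trace x ^+ 2 + (half_trace x ^+ 2) ^+ q.
Proof.
rewrite /trace_form (galTrace_frob card_k dim_L) mul2n.
rewrite (sum_ord_double (fun i => (x * S.[x]) ^+ (q ^ i))) big_split /=.
have A : \sum_(j < m) (x * S.[x]) ^+ (q ^ j.*2) = half_trace x ^+ 2.
  rewrite -(periodic_sum_square (v_period x)); apply: eq_bigr => j _.
  rewrite linearized_product exprMn (frobD card_k) [(2 * _) ^+ _]exprMn.
  rewrite (frob_nat L card_k) (frob_sum card_k).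
  rewrite /v frob_comp add0n; congr (_ * (_ + 2 * _)); apply: eq_bigr => l _.
  by rewrite frob_comp doubleD addnC.
rewrite A; congr (_ + _); rewrite -A -[X in _ ^+ X]expn1 (frob_sum card_k).
by apply: eq_bigr => j _; rewrite frob_comp addn1.
Qed.

(* A nonzero [t] in the field with [q^2] elements with [t^2 + t^(2q) = 0] would
   satisfy [t^(2(q-1)) = -1], while [(q+1)/2] is odd. *)
Lemma trace_form_eq0 x : (trace_form S x == 0) = (half_trace x == 0).
Proof.
rewrite trace_form_half_trace; set t := half_trace x.
apply/eqP/eqP => [H|->]; last by rewrite expr0n /= expr0n gtn_eqF ?addr0 // ltnW.
apply/eqP/negPn/negP => t0.
have tq : t ^+ (q ^ 2).-1 = 1.
  apply: (mulfI t0); rewrite -exprS prednK ?expn_gt0 ?(ltnW q_gt1) // mulr1.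
  exact: half_trace_fixed.
have tm1 : (t ^+ 2) ^+ q.-1 = -1.
  apply: (mulfI (expf_neq0 2 t0)); rewrite -exprS prednK ?(ltnW q_gt1) //.
  by apply/eqP; rewrite mulrN1 -addr_eq0 addrC H.
have [r qE] : exists r, q = (4 * r).+1.
  by exists (q %/ 4)%N; have := divn_eq q 4; rewrite q_mod4; lia.
(* With q = 4 r + 1 one has q^2 - 1 = 2 (q - 1) (2 r + 1), so t^(2(q-1)) = -1 has (2 r + 1)-th power
   1. *)
have : (-1 : L) ^+ (r.*2.+1) = 1.
  rewrite -tm1 -!exprM -[RHS]tq; congr (_ ^+ _); rewrite qE; nia.
rewrite -signr_odd /= odd_double expr1 => /eqP.
by rewrite eq_sym -subr_eq0 opprK (negPf two_neq0).
Qed.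

(** Kernel and image consist of roots of polynomials of degree at most q^(2m-2) and q^2, so their
    dimensions are at most 2m - 2 and 2; the sum 2m forces equality. *)
Lemma dim_lker_half_trace : \dim (lker (linfun half_trace)) = (2 * m - 2)%N.
Proof.
have dk : (\dim (lker (linfun half_trace)) <= 2 * m - 2)%N.
  pose p := \sum_(j < m) b ^+ (q ^ j.*2) *: 'X^(q ^ j.*2).
  apply: (@dim_le_of_roots _ _ _ p).
  - apply/eqP => /(congr1 (fun p : {poly L} => p`_1)); rewrite coef0 /p coef_sum.
    rewrite big_ord_recl big1 => [|j _]; rewrite coefZ coefXn /=.
      by rewrite addr0 mulr1 expr1; apply/eqP.
    rewrite lt_eqF ?mulr0 //; rewrite -(expn0 q) ltEnat /= ltn_exp2l //.
  - apply: (leq_trans (size_sum _ _ _)); apply/bigmax_leqP => j _.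
    apply: (leq_trans (size_scale_leq _ _)); rewrite size_polyXn ltnS card_k leq_exp2l //.
    by move: (ltn_ord j); rewrite /m; lia.
  move=> u; rewrite memv_ker lfunE /= => /eqP <-.
  rewrite horner_sum; apply: eq_bigr => j _.
  by rewrite hornerZ hornerXn exprMn.
have di : (\dim (limg (linfun half_trace)) <= 2)%N.
  have sX : (size ('X : {poly L}) < size ('X^(q ^ 2) : {poly L}))%N.
    by rewrite size_polyX size_polyXn ltnS (leq_trans q_gt1) // -{1}(expn1 q) leq_exp2l.
  apply: (@dim_le_of_roots _ _ _ ('X^(q ^ 2) - 'X)).
  - by rewrite -size_poly_gt0 size_polyDl ?size_polyN // (ltn_trans _ sX) // size_polyX.
  - by rewrite size_polyDl ?size_polyN // size_polyXn card_k.
  move=> _ /memv_imgP[u _ ->]; rewrite lfunE /= !hornerE half_trace_fixed subrr //.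
have := limg_ker_dim (linfun half_trace) {:L}; rewrite capfv dim_L /m; lia.
Qed.

(** With t, u the half traces of x, y, the polar form is 2 (t u + (t u)^q). For x in the radical, y
    = x gives twice the form at x, which vanishes only for t = 0. *)
Lemma half_trace_radical : is_radical (trace_form S) (lker (linfun half_trace)).
Proof.
move=> x; rewrite memv_ker lfunE /=.
have Qp y : polar (trace_form S) x y =
    2 * (half_trace x * half_trace y) + 2 * (half_trace x * half_trace y) ^+ q.
  rewrite /polar !trace_form_half_trace linearD /=.
  have -> : (half_trace x + half_trace y) ^+ 2 = half_trace x ^+ 2 + half_trace y ^+ 2
      + 2 * (half_trace x * half_trace y) by ring.
  have fD (u w : L) : (u + w) ^+ q = u ^+ q + w ^+ q.
    by have := frobD card_k 1 u w; rewrite expn1.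
  rewrite !fD; have := frob_nat L card_k 1 2; rewrite expn1 => f2.
  by rewrite [X in _ + (_ + X)]exprMn f2; ring.
split=> [/eqP hx y|H].
  by rewrite Qp hx mul0r expr0n gtn_eqF ?(ltnW q_gt1) // mulr0 addr0.
rewrite -trace_form_eq0 trace_form_half_trace.
have := H x; rewrite Qp -expr2 -mulrDr => /eqP.
by rewrite mulf_eq0 (negPf two_neq0).
Qed.

End TraceForm.

(** * Counting the solutions of y^q - y = w *)

Section ArtinSchreierCount.

Variables (k : finFieldType) (L : splittingFieldType k) (q n : nat).
Hypothesis card_k : #|k| = q.
Hypothesis dim_L : \dim {:L} = n.+1.

Let q_gt1 : (1 < q)%N := base_gt1 card_k.

Definition AS_map (y : L) : L := y ^+ (q ^ 1) - y.

Lemma AS_map_linear : linear AS_map.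
Proof.
move=> a u v; rewrite /AS_map (frobD card_k) (frobZ card_k) scalerBr opprD.
by rewrite addrACA.
Qed.

HB.instance Definition _ := GRing.isLinear.Build k L L *:%R AS_map AS_map_linear.

Definition frob_trace (u : L) : L := \sum_(i < n.+1) u ^+ (q ^ i).

Lemma frob_trace_linear : linear frob_trace.
Proof.
move=> a u v; rewrite /frob_trace scaler_sumr -big_split; apply: eq_bigr => i _ /=.
by rewrite (frobD card_k) (frobZ card_k).
Qed.

HB.instance Definition _ := GRing.isLinear.Build k L L *:%R frob_trace frob_trace_linear.

(** Additive Hilbert 90 by dimensions: the image lies in the kernel of the trace, of dimension at
    most n, the kernel has dimension at most 1, and rank and nullity add up to n + 1. *)
Lemma AS_map_kernel_image :
  \dim (lker (linfun AS_map)) = 1%N /\ limg (linfun AS_map) = lker (linfun frob_trace).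
Proof.
have sub : (limg (linfun AS_map) <= lker (linfun frob_trace))%VS.
  apply/subvP => _ /memv_imgP[u _ ->]; rewrite memv_ker !lfunE /= linearB /=.
  rewrite subr_eq0; apply/eqP; rewrite /frob_trace.
  rewrite -[RHS](@periodic_sum_shift _ (fun i => u ^+ (q ^ i)) _ 1).
    by apply: eq_bigr => i _; rewrite frob_comp addnC.
  by move=> j; rewrite (frob_period card_k dim_L).
have dk : (\dim (lker (linfun AS_map)) <= 1)%N.
  have sX : (size ('X : {poly L}) < size ('X^(q ^ 1) : {poly L}))%N.
    by rewrite size_polyX size_polyXn ltnS expn1.
  apply: (@dim_le_of_roots _ _ _ ('X^(q ^ 1) - 'X)).
  - by rewrite -size_poly_gt0 size_polyDl ?size_polyN // (ltn_trans _ sX) // size_polyX.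
  - by rewrite size_polyDl ?size_polyN // size_polyXn card_k.
  by move=> u; rewrite memv_ker lfunE /= !hornerE => /eqP.
have dt : (\dim (lker (linfun frob_trace)) <= n)%N.
  pose p : {poly L} := \sum_(i < n.+1) 'X^(q ^ i).
  apply: (@dim_le_of_roots _ _ _ p).
  - apply/eqP => /(congr1 (fun p : {poly L} => p`_1)); rewrite coef0 /p coef_sum.
    rewrite big_ord_recl big1 => [|j _]; rewrite coefXn /=.
      by rewrite addr0; apply/eqP; exact: oner_neq0.
    rewrite lt_eqF //; rewrite -(expn0 q) ltEnat /= ltn_exp2l //.
  - apply: (leq_trans (size_sum _ _ _)); apply/bigmax_leqP => j _.
    by rewrite size_polyXn ltnS card_k leq_exp2l // -ltnS.
  move=> u; rewrite memv_ker lfunE /= => /eqP <-.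
  by rewrite horner_sum; apply: eq_bigr => j _; rewrite hornerXn.
have dims := limg_ker_dim (linfun AS_map) {:L}; rewrite capfv dim_L in dims.
split; first by have := dimvS sub; lia.
by apply/eqP; rewrite eqEdim sub /=; lia.
Qed.

Lemma card_AS_fiber (w : FinFieldExtType L) :
  #|[set y : FinFieldExtType L | y ^+ q - y == w]| =
  if galTrace 1 {:L} (w : L) == 0 then q else 0%N.
Proof.
have [d1 im] := AS_map_kernel_image.
have AE (y : L) : y ^+ q - y = AS_map y by rewrite /AS_map expn1.
have trE : (galTrace 1 {:L} (w : L) == 0) = ((w : L) \in limg (linfun AS_map)).
  by rewrite im memv_ker lfunE /= (galTrace_frob card_k dim_L).
rewrite trE; case: ifP => [/memv_imgP[y0 _]|no].
  rewrite lfunE /= => wE.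
  have -> : [set y : FinFieldExtType L | y ^+ q - y == w] =
      [set (y0 : FinFieldExtType L) + z | z in (lker (linfun AS_map) : {pred L})].
    apply/setP => y; rewrite inE AE; apply/eqP/imsetP => [yw|[z zk ->]].
      exists ((y : L) - y0); last by rewrite addrC subrK.
      by rewrite memv_ker lfunE /= linearB /= yw wE subrr.
    rewrite linearD /= wE; move: zk; rewrite memv_ker lfunE /= => /eqP ->.
    by rewrite addr0.
  rewrite card_imset; last exact: addrI.
  by rewrite (@card_vspace k (finvect_type L) _ (lker (linfun AS_map))) d1 expn1.
apply: eq_card0 => y; rewrite inE AE; apply/eqP => E.
by move: no; rewrite -E -lfunE memv_img // memvf.
Qed.

End ArtinSchreierCount.

Lemma card_set_fibers (T1 T2 : finType) (R : T1 -> T2 -> bool) :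
  #|[set P : T1 * T2 | R P.1 P.2]| = (\sum_x #|[set y | R x y]|)%N.
Proof.
rewrite -sum1dep_card -(pair_big_dep xpredT R (fun _ _ => 1%N)).
by apply: eq_bigr => x _; rewrite sum1dep_card.
Qed.

(** * Assembly: square root of s_0, radical, genus and number of points *)

Theorem corollary2
  (k : finFieldType) (q m : nat)
  (hq : #|k| = q) (hq4 : q = 1 %[mod 4])
  (hm2 : (2 <= m)%N) (hm : odd m)
  (L : splittingFieldType k) (hL : \dim {:L} = (2 * m)%N)
  (E : {subfield L}) (hE : \dim E = m)
  (s : nat -> L) (S : {poly L})
  (hsE : forall i, (i < m)%N -> s i \in E)
  (hS : S = \sum_(i < m) s i *: 'X^(q ^ i))
  (hs0 : s 0%N * s m.-1 != 0)
  (hs : forall i, (1 <= i)%N -> (i < m)%N ->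
     s i = if odd i then 0 else 2 * s 0%N ^+ ((q ^ i + 1) %/ 2)) :
  (exists2 W : {vspace L}, is_radical (trace_form S) W & \dim W = (2 * m - 2)%N)
  /\ @AS_minimal (FinFieldExtType L) q ('X * S).
Proof.
have q1 : (1 < q)%N := base_gt1 hq.
have oq := odd_q hq4.
have cK : #|FinFieldExtType L| = (q ^ (2 * m))%N.
  rewrite -hq -hL -(@card_vspace k (finvect_type L) _ {:L}).
  exact/esym/(@card_vspacef k (finvect_type L)).
have s00 : s 0%N != 0 by apply: contraNneq hs0 => ->; rewrite mul0r.
(* An element of the field with q^m elements is a square in L: (q^(2m) - 1) / 2 is q^m - 1 times the
   integer (q^m + 1) / 2. *)
have [b b2] : exists b : L, b ^+ 2 = s 0%N.
  apply: (@finField_sqrt (FinFieldExtType L) (s 0%N)); rewrite cK.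
    by rewrite oddX oq orbT.
  have sq : s 0%N ^+ (q ^ m).-1 = 1.
    apply: (mulfI s00); rewrite -exprS prednK ?expn_gt0 ?(ltnW q1) // mulr1.
    have := hsE 0%N (ltnW hm2); rewrite Fermat's_little_theorem hE hq => /eqP //.
  have [r rE] : exists r, (q ^ m = r.*2.+1)%N.
    by exists (q ^ m)./2; rewrite -[LHS]odd_double_half oddX oq orbT.
  have -> : ((q ^ (2 * m)).-1./2 = (q ^ m).-1 * r.+1)%N.
    rewrite mulnC expnM expnS expn1 rE; nia.
  by rewrite exprM sq expr1n.
have b0 : b != 0 by apply: contraNneq s00 => b0; rewrite -b2 b0 expr0n.
pose h := m./2; have mE : m = h.*2.+1 by rewrite -[LHS]odd_double_half hm.
have mE1 : m.-1.+1 = m by rewrite prednK // ltnW.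
have dimL : \dim {:L} = (2 * h.*2.+1)%N by rewrite -mE.
have hs' i : (1 <= i)%N -> (i < h.*2.+1)%N ->
    s i = if odd i then 0 else 2 * s 0%N ^+ ((q ^ i + 1) %/ 2).
  by rewrite -mE; exact: hs.
have hS' : S = \sum_(i < h.*2.+1) s i *: 'X^(q ^ i) by rewrite -mE.
pose W := lker (linfun (half_trace q h b)).
have dimW : \dim W = (2 * m - 2)%N by rewrite mE; exact: (dim_lker_half_trace hq hq4 dimL b0).
split.
  exists W => //; exact: (half_trace_radical hq hq4 dimL b2 b0 hs' hS').
(* The degree of x S(x), as s_(m-1) is nonzero; it is prime to q because m > 1. *)
pose d := (q ^ m.-1).+1.
have sm0 : s m.-1 != 0 by apply: contraNneq hs0 => ->; rewrite mulr0.
have sS : size S = d.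
  rewrite hS -[in LHS]mE1 big_ord_recr /= addrC size_polyDl size_scale // size_polyXn //.
  rewrite ltnS; apply: (leq_trans (size_sum _ _ _)); apply/bigmax_leqP => i _.
  by apply: (leq_trans (size_scale_leq _ _)); rewrite size_polyXn ltn_exp2l.
have sf : size ('X * S) = d.+1.
  by rewrite mulrC size_mulX ?sS // -size_poly_gt0 sS.
have cop : coprime q d.
  apply: (coprime_dvdl _ (coprimenS _)); apply: dvdn_exp => //.
  by rewrite -ltnS mE1.
have d1 : (1 < d)%N by rewrite /d ltnS expn_gt0 ltnW.
have pc : [pchar FinFieldExtType L].-nat q.
  by have := ext_pchar L hq 1; rewrite expn1.
have [F [asF genF]] := @AS_function_field_exists (FinFieldExtType L) q d ('X * S) pc q1 d1 cop sf.
exists F, #|gap_set q d|; split=> //.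
have g2 := card_gap_set cop; rewrite [d.-1]/= in g2.
have card_pts : AS_num_points q ('X * S : {poly FinFieldExtType L}) = (q ^ (2 * m - 1)).+1.
  rewrite /AS_num_points (card_set_fibers (fun x y : FinFieldExtType L =>
     y ^+ q - y == ('X * S : {poly FinFieldExtType L}).[x])); congr _.+1.
  have nE : \dim {:L} = (2 * m).-1.+1 by rewrite hL prednK // muln_gt0 /= ltnW.
  (* The form vanishes exactly on the radical, so each x there carries q values of y and every other
     x none. *)
  rewrite (eq_bigr (fun x : FinFieldExtType L => if (x : L) \in W then q else 0%N)).
    rewrite -big_mkcond sum_nat_const (@card_vspace k (finvect_type L) _ W) dimW hq.
    by rewrite -expnSr; congr (q ^ _)%N; lia.
  move=> x _; rewrite (card_AS_fiber hq nE) memv_ker lfunE /=.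
  rewrite -(trace_form_eq0 hq hq4 dimL b2 b0 hs' hS') /trace_form hornerM hornerX //.
rewrite card_pts cK.
have -> : sqrtC (q ^ (2 * m))%:R = (q ^ m)%:R :> algC.
  by rewrite mulnC expnM natrX sqrCK // ler0n.
have -> : (2 * #|gap_set q d|%:R : algC) = (q.-1 * q ^ m.-1)%:R.
  by rewrite -g2 -mul2n natrM.
(* With 2 g = (q - 1) q^(m-1), this is 2 g q^m = q^(2m) - q^(2m-1). *)
have -> : (q ^ (2 * m))%N = (q ^ (2 * m - 1) + q.-1 * q ^ m.-1 * q ^ m)%N.
  have -> : (q ^ (2 * m) = q * q ^ (2 * m - 1))%N by rewrite -expnS; congr (q ^ _)%N; lia.
  rewrite -mulnA -expnD (_ : m.-1 + m = 2 * m - 1)%N; last by lia.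
  by rewrite -mulSn prednK // ltnW.
by rewrite -addn1 !natrD !natrM; ring.
Qed.
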